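(* Let $\mathcal V=\{1,\dots,n\}$, let $X\subset\mathbb R^m$ be a nonempty closed convex set, and let $f_i:\mathbb R^m\to\mathbb R$ ($i\in\mathcal V$) be convex on an open convex set $U_i\supset X$. Suppose there is $L>0$ with $|d|\le L$ for all $d\in\partial f_i(x)$, $x\in X$, $i\in\mathcal V$. Let the stepsizes $\alpha_k>0$ satisfy $\sum_{k=0}^\infty\alpha_k=\infty$ and $\sum_{k=0}^\infty\alpha_k^2<\infty$. For $i\in\mathcal V$ let $$X_i^*=\Big\{z\in X: f_i(z)=\min_{x\in X}f_i(x)\Big\}.$$ Then the following are equivalent: (a) for every sequence $\{A(k)\}_{k\in\mathbb N}$ of $n\times n$ weight matrices which satisfies the weight rule and whose associated graph sequence $\{\mathcal G(k)\}$ is uniformly jointly strongly connected, the distributed projected subgradient algorithm with weight matrices $A(k)$ achieves a solution to the problem $\min_{x\in X}\sum_{i\in\mathcal V}f_i(x)$; (b) $\bigcap_{i\in\mathcal V}X_i^*\neq\emptyset$.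
   Context: $\mathbb N$ is the set of nonnegative integers, $|\cdot|$ is the Euclidean norm, and $x'$ denotes transpose. For $x\in U_i$, $\partial f_i(x)$ is the set of $g\in\mathbb R^m$ such that $f_i(y)-f_i(x)\ge (y-x)'g$ for all $y\in U_i$. $P_X(x)$ is the unique point of $X$ nearest to $x$ in Euclidean norm. The graph associated with a nonnegative matrix $A=[a_{ij}]$ has node set $\mathcal V$ and a directed edge $(j,i)$ if and only if $a_{ij}>0$; it is strongly connected if there is a directed path from every node to every other node. Weight rule for $A(k)=[a_{ij}(k)]$: each $A(k)$ is nonnegative with $\sum_{j\in\mathcal V}a_{ij}(k)=1$ for all $i$ and $k$ (row stochastic), and there is $0<\eta<1$ (independent of $k$) such that $a_{ij}(k)\ge\eta$ whenever $a_{ij}(k)>0$ and $a_{ii}(k)\ge\eta$ for all $i,j\in\mathcal V$, $k\in\mathbb N$. Uniformly jointly strongly connected (UJSC): there is an integer $B>0$ such that for every $k\in\mathbb N$ the graph on $\mathcal V$ whose edge set is the union of the edge sets of $\mathcal G(k),\dots,\mathcal G(k+B-1)$ is strongly connected. Distributed projected subgradient algorithm: each agent $i\in\mathcal V$ starts from $x_i(0)\in\mathbb R^m$ and, for $k\in\mathbb N$, $$v_i(k)=\sum_{j\in\mathcal V}a_{ij}(k)x_j(k),\qquad x_i(k+1)=P_X\big(v_i(k)-\alpha_k d_i(k)\big),\qquad d_i(k)\in\partial f_i(v_i(k)).$$ The algorithm achieves a solution to $\min_{x\in X}F(x)$ if for every initial condition and every sequences generated by the recursion, $\lim_{k\to\infty}|x_i(k)-x_j(k)|=0$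 for all $i,j\in\mathcal V$, and there is a minimizer $x^*$ of $F$ over $X$ with $\lim_{k\to\infty}|x_i(k)-x^*|=0$ for all $i\in\mathcal V$. *)

(* Defs.v *)
From mathcomp Require Import all_boot all_order all_algebra.
From mathcomp Require Import all_classical all_reals all_analysis.

Set Implicit Arguments.
Unset Strict Implicit.
Unset Printing Implicit Defensive.

Import Order.TTheory GRing.Theory Num.Theory.
Import numFieldNormedType.Exports.

Local Open Scope classical_set_scope.
Local Open Scope ring_scope.

Section Euclidean.
Variables (R : realType) (m : nat).
Implicit Types (x y g : 'rV[R]_m) (X U : set 'rV[R]_m) (f : 'rV[R]_m -> R).

Definition dot x y : R := \sum_(t < m) x 0 t * y 0 t.

(* The library norm on 'rV[R]_m is the sup norm; it has the same topology but
   a different nearest-point map. *)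
Definition enorm x : R := Num.sqrt (dot x x).

(* Empty at points outside U. *)
Definition subdiff U f x : set 'rV[R]_m :=
  [set g | U x /\ forall y, U y -> dot (y - x) g <= f y - f x].

Definition argmin X f : set 'rV[R]_m :=
  [set z | X z /\ forall x, X x -> f z <= f x].

(* The nearest point exists and is unique when X is nonempty, closed and
   convex; the default value 0 is used only when there is no nearest point. *)
Definition proj X x : 'rV[R]_m := xget 0 (argmin X (fun p => enorm (x - p))).

End Euclidean.

Section Graphs.
Variables (R : realType) (n : nat).
Implicit Types (A : nat -> 'M[R]_n).

(* The entry in row i and column j is the weight of the edge from j to i. *)
Definition edge (M : 'M[R]_n) : rel 'I_n := fun j i => 0 < M i j.

Definition strongly_connected (e : rel 'I_n) : Prop :=
  forall i j, i != j -> connect e i j.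

Definition union_edge A (k B : nat) : rel 'I_n :=
  fun j i => [exists s : 'I_B, edge (A (k + s)%N) j i].

Definition UJSC A : Prop :=
  exists2 B : nat, (0 < B)%N & forall k, strongly_connected (union_edge A k B).

Definition weight_rule A : Prop :=
  [/\ forall k i j, 0 <= A k i j,
      forall k i, \sum_(j < n) A k i j = 1 &
      exists2 eta : R, 0 < eta < 1 &
        forall i j k, (0 < A k i j -> eta <= A k i j) /\ eta <= A k i i].

End Graphs.

Section Algorithm.
Variables (R : realType) (m n : nat).
Variables (X : set 'rV[R]_m) (U : 'I_n -> set 'rV[R]_m).
Variables (f : 'I_n -> 'rV[R]_m -> R) (alpha : nat -> R) (A : nat -> 'M[R]_n).

(* x k i, v k i and d k i are x_i(k), v_i(k) and d_i(k); the initial condition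
   x 0 is arbitrary. *)
Definition generated (x v d : nat -> 'I_n -> 'rV[R]_m) : Prop :=
  forall k i,
    [/\ v k i = \sum_(j < n) A k i j *: x k j,
        subdiff (U i) (f i) (v k i) (d k i) &
        x k.+1 i = proj X (v k i - alpha k *: d k i)].

Definition achieves_solution (F : 'rV[R]_m -> R) : Prop :=
  forall x v d : nat -> 'I_n -> 'rV[R]_m, generated x v d ->
    (forall i j, enorm (x k i - x k j) @[k --> \oo] --> (0 : R)) /\
    exists2 z, argmin X F z &
      forall i, enorm (x k i - z) @[k --> \oo] --> (0 : R).

End Algorithm.

(* Main.v *)
(* (b) => (a): if z minimises every f_i over X, then max_i |x_i(k) - z|^2
   increases by at most L^2 alpha_k^2 per step.  Products of the weight matrices
   over a window of n B steps have all entries >= eta^(n B); hence the agents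
   reach consensus, and any suboptimality f_i(v_i(k)) - f_i(z) lowers the maximum
   by a fixed fraction of alpha_k (f_i(v_i(k)) - f_i(z)) within one window.  So
   sum_k alpha_k (f_i(v_i(k)) - f_i(z)) < oo, some cluster point minimises every
   f_i, and the quasi-monotonicity with respect to that point gives convergence.

   (a) => (b): for t in (0,1), let all rows of A(k) equal (1 - t) u + t e_i, with
   u uniform and i = floor(alpha_0 + ... + alpha_(k-2)) mod n: each i is then
   used during infinitely many epochs of total stepsize about 1, so the limit z_t
   minimises (1 - t) / n F + t f_i for every i, and F by (a).  Comparing these
   minimisers shows that f_i(z_t) does not depend on t, and t -> 1 shows that
   z_(1/2) minimises every f_i. *)
Require Import Defs.
From mathcomp Require Import all_boot all_order all_algebra.
From mathcomp Require Import all_classical all_reals all_analysis.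
From mathcomp Require Import ring lra zify.

Set Implicit Arguments.
Unset Strict Implicit.
Unset Printing Implicit Defensive.

Import Order.TTheory GRing.Theory Num.Theory.
Import numFieldNormedType.Exports.

Local Open Scope classical_set_scope.
Local Open Scope ring_scope.

(** * Inner product and Euclidean norm *)

Section EuclideanNorm.
Variables (R : realType) (m : nat).
Implicit Types (x y z : 'rV[R]_m) (a : R).

Lemma dotC x y : dot x y = dot y x.
Proof. by apply: eq_bigr => t _; rewrite mulrC. Qed.

Lemma dotDl x y z : dot (x + y) z = dot x z + dot y z.
Proof. by rewrite -big_split; apply: eq_bigr => t _; rewrite mxE mulrDl. Qed.

Lemma dotZl a x y : dot (a *: x) y = a * dot x y.
Proof. by rewrite mulr_sumr; apply: eq_bigr => t _; rewrite mxE mulrA. Qed.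

Lemma dotDr x y z : dot z (x + y) = dot z x + dot z y.
Proof. by rewrite !(dotC z) dotDl. Qed.

Lemma dotZr a x y : dot x (a *: y) = a * dot x y.
Proof. by rewrite !(dotC x) dotZl. Qed.

Lemma dotNl x y : dot (- x) y = - dot x y.
Proof. by rewrite -scaleN1r dotZl mulN1r. Qed.

Lemma dotNr x y : dot x (- y) = - dot x y.
Proof. by rewrite !(dotC x) dotNl. Qed.

Lemma dot0l x : dot 0 x = 0.
Proof. by rewrite -(scale0r 0) dotZl mul0r. Qed.

Lemma dot_suml (I : finType) (w : I -> 'rV[R]_m) y :
  dot (\sum_i w i) y = \sum_i dot (w i) y.
Proof.
apply: (big_morph (fun x => dot x y)) => [u v|]; first exact: dotDl.
exact: dot0l.
Qed.

Lemma dot_ge0 x : 0 <= dot x x.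
Proof. by apply: sumr_ge0 => t _; rewrite -expr2 sqr_ge0. Qed.

Lemma enorm_ge0 x : 0 <= enorm x.
Proof. exact: sqrtr_ge0. Qed.

Lemma sqr_enorm x : enorm x ^+ 2 = dot x x.
Proof. by rewrite sqr_sqrtr // dot_ge0. Qed.

Lemma le_enormP x a : 0 <= a -> (enorm x <= a) = (dot x x <= a ^+ 2).
Proof. by move=> a0; rewrite -sqr_enorm ler_sqr // nnegrE ?enorm_ge0. Qed.

Lemma enorm_le_dot x y : (enorm x <= enorm y) = (dot x x <= dot y y).
Proof. by rewrite le_enormP ?enorm_ge0 // sqr_enorm. Qed.

Lemma enorm0 : enorm (0 : 'rV[R]_m) = 0.
Proof. by rewrite /enorm dot0l sqrtr0. Qed.

Lemma enormN x : enorm (- x) = enorm x.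
Proof. by rewrite /enorm dotNl dotNr opprK. Qed.

Lemma enorm_distC x y : enorm (x - y) = enorm (y - x).
Proof. by rewrite -enormN opprB. Qed.

Lemma enormZ a x : enorm (a *: x) = `|a| * enorm x.
Proof.
by rewrite /enorm dotZl dotZr mulrA -expr2 sqrtrM ?sqr_ge0 // sqrtr_sqr.
Qed.

Lemma norm_le_enorm x : `|x| <= enorm x.
Proof.
rewrite [leLHS]/Num.norm /= mx_normrE; apply/bigmax_leP; split=> [|[i t] _ /=].
  exact: enorm_ge0.
rewrite -sqrtr_sqr ler_wsqrtr // ord1 expr2.
rewrite /dot (bigD1 t) //= lerDl; apply: sumr_ge0 => s _.
by rewrite -expr2 sqr_ge0.
Qed.

(** A crude constant: [m.+1] rather than the square root of [m], so that it is positive, and can be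
    divided by, even for [m = 0]. *)
Lemma enorm_le_norm x : enorm x <= m.+1%:R * `|x|.
Proof.
have nx0 : 0 <= `|x| by exact: normr_ge0.
rewrite le_enormP ?mulr_ge0 //.
have H t : x 0 t * x 0 t <= `|x| ^+ 2.
  rewrite -expr2 -real_normK ?num_real // ler_sqr ?nnegrE //.
  rewrite [leRHS]/Num.norm /= mx_normrE.
  exact: (le_bigmax _ (fun p : 'I_1 * 'I_m => `|x p.1 p.2|) (0, t)).
apply: le_trans (ler_sum _ (fun t _ => H t)) _.
rewrite sumr_const card_ord -[leLHS]mulr_natl exprMn ler_wpM2r ?sqr_ge0 //.
by rewrite -natrX ler_nat; lia.
Qed.

Lemma enorm_eq0_dot x y : enorm y = 0 -> dot x y = 0.
Proof.
move=> y0; apply: big1 => t _; suff -> : y 0 t = 0 by rewrite mulr0.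
have : dot y y = 0 by rewrite -sqr_enorm y0 expr0n.
move/psumr_eq0P => H; apply/eqP; rewrite -sqrf_eq0 expr2; apply/eqP.
by apply: H => // i _; rewrite -expr2 sqr_ge0.
Qed.

(** Cauchy-Schwarz, by expanding the square of [enorm y *: x - enorm x *: y]; vanishing norms are
    treated first because the product of the norms is cancelled. *)
Lemma dot_le x y : dot x y <= enorm x * enorm y.
Proof.
have [y0|y0] := eqVneq (enorm y) 0; first by rewrite enorm_eq0_dot // y0 mulr0.
have [x0|x0] := eqVneq (enorm x) 0.
  by rewrite dotC enorm_eq0_dot // x0 mul0r.
have x1 : 0 < enorm x by rewrite lt_neqAle eq_sym x0 enorm_ge0.
have y1 : 0 < enorm y by rewrite lt_neqAle eq_sym y0 enorm_ge0.
have := dot_ge0 (enorm y *: x - enorm x *: y).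
rewrite !(dotDl, dotDr, dotNl, dotNr, dotZl, dotZr) (dotC y x) -!sqr_enorm.
move=> H; rewrite -(ler_pM2l (mulr_gt0 x1 y1)); nra.
Qed.

Lemma enormD x y : enorm (x + y) <= enorm x + enorm y.
Proof.
rewrite le_enormP ?addr_ge0 ?enorm_ge0 //.
rewrite !(dotDl, dotDr) (dotC y x) -!sqr_enorm.
have := dot_le x y; lra.
Qed.

Lemma enorm_triangle x y z : enorm (x - y) <= enorm (x - z) + enorm (z - y).
Proof. by apply: le_trans (enormD _ _); rewrite addrA subrK. Qed.

Lemma enorm_wsum (I : finType) (a : I -> R) (w : I -> 'rV[R]_m) (c : R) :
  (forall i, 0 <= a i) -> (forall i, enorm (w i) <= c) ->
  enorm (\sum_i a i *: w i) <= (\sum_i a i) * c.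
Proof.
move=> a0 wc; rewrite mulr_suml.
elim/big_ind2: _ => [|u p v q H1 H2|i _]; first by rewrite enorm0.
  exact: le_trans (enormD _ _) (lerD H1 H2).
by rewrite enormZ ger0_norm // ler_wpM2l.
Qed.

(** Convexity of the squared distance, through the variance identity: the right side minus the left
    side is the weighted sum of the squared distances from the [w i] to their mean. *)
Lemma dot_wsum (I : finType) (a : I -> R) (w : I -> 'rV[R]_m) z :
  (forall i, 0 <= a i) -> \sum_i a i = 1 ->
  dot (\sum_i a i *: w i - z) (\sum_i a i *: w i - z)
    <= \sum_i a i * dot (w i - z) (w i - z).
Proof.
move=> a0 a1; set u := \sum_i _.
have uz : u - z = \sum_i a i *: (w i - z).
  under eq_bigr => i _ do rewrite scalerBr.
  by rewrite sumrB -scaler_suml a1 scale1r.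
have : 0 <= \sum_i a i * dot (w i - u) (w i - u).
  by apply: sumr_ge0 => i _; rewrite mulr_ge0 // dot_ge0.
have -> : \sum_i a i * dot (w i - u) (w i - u) =
   \sum_i (a i * dot (w i - z) (w i - z) - 2 * dot (a i *: (w i - z)) (u - z)
     + a i * dot (u - z) (u - z)).
  apply: eq_bigr => i _.
  have -> : w i - u = (w i - z) - (u - z) by rewrite opprB addrA subrK.
  move: (w i - z) (u - z) => p q.
  rewrite !(dotDl, dotDr, dotNl, dotNr, dotZl, dotZr) (dotC q p).
  ring.
rewrite big_split sumrB /= -mulr_suml a1 -mulr_sumr -dot_suml -uz.
lra.
Qed.

End EuclideanNorm.

(** * Compactness and convex combinations *)

Lemma invS_lt (R : realType) (e : R) : 0 < e -> exists N, N.+1%:R^-1 < e.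
Proof.
move=> e0; exists (Num.truncn e^-1).
by rewrite invf_plt ?posrE // truncnS_gt.
Qed.

Section EuclideanTopology.
Variables (R : realType) (m : nat).
Implicit Types (x y z : 'rV[R]_m) (X : set 'rV[R]_m).

Lemma closed_enorm X x : closed X ->
  (forall e, 0 < e -> exists2 y, X y & enorm (y - x) <= e) -> X x.
Proof.
move=> Xc Xx; apply: Xc => B /nbhs_ballP[e /= e0 eB].
have [|y Xy yx] := Xx (e / 2); first by rewrite divr_gt0.
exists y; split=> //; apply: eB; rewrite -ball_normE /= distrC.
by have := norm_le_enorm (y - x); lra.
Qed.

Lemma open_enorm X x : open X -> X x ->
  exists2 e, 0 < e & forall y, enorm (y - x) < e -> X y.
Proof.
rewrite openE => Xo /Xo /nbhs_ballP[e /= e0 eB].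
exists e => // y yx; apply: eB; rewrite -ball_normE /= distrC.
by have := norm_le_enorm (y - x); lra.
Qed.

(** Bolzano-Weierstrass: closed balls of the sup norm are compact, and the comparison of the two
    norms carries the cluster point over to [enorm]. *)
Lemma bounded_cluster (u : nat -> 'rV[R]_m) (c : R) :
  (forall k, enorm (u k) <= c) ->
  exists x, forall e, 0 < e -> forall N, exists2 k, (N <= k)%N & enorm (u k - x) < e.
Proof.
move=> uc.
have Kc : compact [set y : 'rV[R]_m | `|y| <= c].
  apply: bounded_closed_compact.
    exists c; split=> [|M cM y /= yc]; first exact: num_real.
    exact: le_trans yc (ltW cM).
  rewrite (_ : [set _ | _] = (fun y : 'rV[R]_m => `|y|) @^-1` [set a | a <= c]) //.
  apply: closed_comp; last exact: closed_le.
  by move=> y _; apply: norm_continuous.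
have [|x [_ ux]] := Kc (u @ \oo).
  by exists 0 => // k _; exact: le_trans (norm_le_enorm _) (uc k).
exists x => e e0 N.
have m0 : 0 < m.+1%:R :> R by rewrite ltr0n.
have [||y [[k /= Nk <-] ]] :=
    ux [set u k | k in [set k | (N <= k)%N]] (ball x (e / m.+1%:R)).
- by exists N => // k /= Nk; exists k.
- by apply: nbhsx_ballx; rewrite divr_gt0.
rewrite -ball_normE /= distrC ltr_pdivlMr // mulrC => H.
by exists k => //; apply: le_lt_trans (enorm_le_norm _) H.
Qed.

Lemma convex_set_line X x y (t : R) : convex_set X -> X x -> X y ->
  0 <= t -> t <= 1 -> X (t *: x + (1 - t) *: y).
Proof.
move=> Xc Xx Xy t0 t1.
have := Xc x y (Itv01 t0 t1); rewrite !inE => /(_ Xx Xy).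
exact.
Qed.

Lemma convex_function_line (X : set 'rV[R]_m) (f : 'rV[R]_m -> R) x y (t : R) :
  convex_function X f -> X x -> X y -> 0 <= t -> t <= 1 ->
  f (t *: x + (1 - t) *: y) <= t * f x + (1 - t) * f y.
Proof.
move=> fc Xx Xy t0 t1.
have := fc (Itv01 t0 t1) x y; rewrite !inE => /(_ Xx Xy).
exact.
Qed.

(** Induction on the list of indices, with partial sums rescaled to total mass 1; a tail of mass 0
    contributes nothing and is split off to avoid dividing by 0. *)
Lemma convex_set_sum X (I : finType) (a : I -> R) (w : I -> 'rV[R]_m) :
  convex_set X -> (forall i, 0 <= a i) -> \sum_i a i = 1 ->
  (forall i, X (w i)) -> X (\sum_i a i *: w i).
Proof.
move=> Xc a0 a1 Xw.
suff H (s : seq I) : 0 < \sum_(i <- s) a i ->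
    X ((\sum_(i <- s) a i)^-1 *: \sum_(i <- s) a i *: w i).
  by have := H (index_enum I); rewrite a1 invr1 scale1r; apply.
elim: s => [|i s IH]; first by rewrite big_nil ltxx.
rewrite !big_cons; set b := \sum_(j <- s) a j; set u := \sum_(j <- s) _ => ab.
have b0 : 0 <= b by apply: sumr_ge0.
have [b1|b1] := eqVneq b 0.
  have -> : u = 0.
    rewrite /u big1_seq // => j /andP[_ js].
    have := b1; rewrite /b => /eqP; rewrite psumr_eq0 // => /allP /(_ j js).
    by move=> /= /eqP ->; rewrite scale0r.
  rewrite b1 !addr0 scalerA mulVf ?scale1r //.
  by move: ab; rewrite b1 addr0 => /lt0r_neq0.
have -> : (a i + b)^-1 *: (a i *: w i + u) =
   (a i / (a i + b)) *: w i + (1 - a i / (a i + b)) *: (b^-1 *: u).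
  rewrite scalerDr !scalerA; congr (_ *: _ + _ *: _); field.
    by rewrite gt_eqF.
  by rewrite b1 gt_eqF.
apply: convex_set_line => //.
- by apply: IH; rewrite lt_neqAle eq_sym b1.
- by rewrite divr_ge0 // ltW.
- by rewrite ler_pdivrMr // mul1r lerDl.
Qed.

End EuclideanTopology.

(** * Projection onto a closed convex set *)

Section Projection.
Variables (R : realType) (m : nat) (X : set 'rV[R]_m).
Hypotheses (X0 : X !=set0) (Xc : closed X) (Xv : convex_set X).

(** A minimising sequence is bounded, so it has a cluster point; closedness puts that point in [X],
    and the triangle inequality shows that it attains the infimum. *)
Lemma nearest_exists (x : 'rV[R]_m) : exists p, argmin X (fun p => enorm (x - p)) p.
Proof.
pose D := [set enorm (x - p) | p in X].
have D0 : has_inf D.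
  split; first by have [p Xp] := X0; exists (enorm (x - p)), p.
  by exists 0 => _ [p _ <-]; exact: enorm_ge0.
have Dn k : exists p, X p /\ enorm (x - p) < inf D + k.+1%:R^-1.
  have [|_ [p Xp <-] H] := inf_adherent (_ : 0 < k.+1%:R^-1) D0.
    by rewrite invr_gt0.
  by exists p.
have [u /all_and2[uX uD]] := choice Dn.
have [k|p up] := @bounded_cluster R m u (enorm x + inf D + 1).
  have := enormD (x) (u k - x); rewrite subrKC enorm_distC.
  have := uD k; have : k.+1%:R^-1 <= 1 :> R by rewrite invf_le1 // ler1n.
  by move: (k.+1%:R^-1) => r; lra.
exists p; split.
  apply: closed_enorm => // e e0; have [k _ H] := up e e0 0.
  by exists (u k) => //; exact: ltW.
move=> y Xy.
have : inf D <= enorm (x - y) by apply: ge_inf; [case: D0|exists y].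
apply: le_trans; apply/ler_addgt0Pr => e e0.
have e2 : 0 < e / 2 by rewrite divr_gt0.
have [N HN] := invS_lt e2.
have [k Nk uk] := up (e / 2) e2 N.
have := enorm_triangle x p (u k); have := uD k.
have : k.+1%:R^-1 <= N.+1%:R^-1 :> R by rewrite lef_pV2 ?posrE // ler_nat.
by move: (k.+1%:R^-1) (N.+1%:R^-1) HN => r r'; lra.
Qed.

Lemma projP (x : 'rV[R]_m) : argmin X (fun p => enorm (x - p)) (Defs.proj X x).
Proof. by have [p pmin] := nearest_exists x; exact: xgetI pmin. Qed.

Lemma proj_in (x : 'rV[R]_m) : X (Defs.proj X x).
Proof. by have [] := projP x. Qed.

(** Follows from the variational inequality: the angle at the projection between [x] and any point
    of [X] is not acute. *)
Lemma proj_nonexp (x y : 'rV[R]_m) : X y ->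
  dot (Defs.proj X x - y) (Defs.proj X x - y) <= dot (x - y) (x - y).
Proof.
move=> Xy; have := projP x; set p := Defs.proj X x => -[Xp pmin].
suff H : dot (x - p) (y - p) <= 0.
  have -> : x - y = (x - p) - (y - p) by rewrite opprB addrA subrK.
  have -> : p - y = - (y - p) by rewrite opprB.
  move: (x - p) (y - p) H (dot_ge0 (x - p)) => a b H1 H2.
  by rewrite !(dotDl, dotDr, dotNl, dotNr) (dotC b a); lra.
(* The projection is compared with the points of the segment from [p] to [y], which lie in [X]. *)
have Ht t : 0 < t -> t <= 1 -> dot (x - p) (y - p) <= t * dot (y - p) (y - p).
  move=> t0 t1.
  have := pmin _ (convex_set_line Xv Xy Xp (ltW t0) t1).
  rewrite enorm_le_dot.
  have -> : x - (t *: y + (1 - t) *: p) = (x - p) - t *: (y - p).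
    by apply/rowP => i; rewrite !mxE; ring.
  move: (x - p) (y - p) (dot_ge0 (y - p)) => a b b0.
  rewrite !(dotDl, dotDr, dotNl, dotNr, dotZl, dotZr) (dotC b a) => H.
  rewrite -(ler_pM2l t0); nra.
rewrite leNgt; apply/negP => s0.
have q0 := dot_ge0 (y - p).
have := Ht 1 ltr01 (lexx _); rewrite mul1r => sq.
have q1 : 0 < dot (y - p) (y - p) by lra.
(* This [t] is half the ratio of the two products, at most 1 by the case [t = 1]; it bounds the
   positive product by its own half. *)
have := Ht (dot (x - p) (y - p) / dot (y - p) (y - p) / 2).
rewrite divr_gt0 ?divr_gt0 // => /(_ isT).
rewrite ler_pdivrMr // ler_pdivrMr // => /(_ ltac:(lra)).
by rewrite mulrAC divfK ?gt_eqF //; lra.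
Qed.

End Projection.

(** * Existence of subgradients *)

Section Subgradient.
Variables (R : realType) (m : nat) (U : set 'rV[R]_m) (f : 'rV[R]_m -> R).
Hypotheses (Uo : open U) (Uc : convex_set U) (fc : convex_function U f).

(** The span of the first [s] coordinate vectors; a subgradient is built along this chain of
    subspaces. *)
Definition zero_from (s : nat) : set 'rV[R]_m :=
  [set h | forall t : 'I_m, (s <= t)%N -> h 0 t = 0].

(* One-dimensional Hahn-Banach extension: convexity makes every slope phi h / h_s
   on the side h_s < 0 at most every slope on the side h_s > 0, so their supremum
   is an admissible coefficient. *)
Lemma subgradient_extend (x g : 'rV[R]_m) (s : 'I_m) : U x ->
  (forall h, zero_from s h -> U (x + h) -> dot h g <= f (x + h) - f x) ->
  exists c, forall h, zero_from s.+1 h -> U (x + h) ->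
    dot h (g + c *: delta_mx 0 s) <= f (x + h) - f x.
Proof.
move=> Ux Hg.
pose phi h := f (x + h) - f x - dot h g.
pose S := [set h | zero_from s.+1 h /\ U (x + h)].
have S_line h h' : S h -> S h' -> h 0 s < 0 -> 0 < h' 0 s ->
    phi h / h 0 s <= phi h' / h' 0 s.
  move=> [h0 Uh] [h0' Uh']; set a := h 0 s; set b := h' 0 s => an bp.
  have ba : 0 < b - a by lra.
  (* The weight for which coordinate [s] of the combination of [h] and [h'] vanishes, so that [Hg]
     applies to it. *)
  pose t := b / (b - a).
  have t0 : 0 <= t by rewrite divr_ge0 // ltW.
  have t1 : t <= 1 by rewrite ler_pdivrMr //; lra.
  have tE : 1 - t = - a / (b - a) by rewrite /t; field; lra.
  pose w := t *: h + (1 - t) *: h'.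
  have xw : x + w = t *: (x + h) + (1 - t) *: (x + h').
    by apply/rowP => i; rewrite !mxE; ring.
  have w0 : zero_from s w.
    move=> i; rewrite leq_eqVlt => /orP[/eqP si|si]; rewrite !mxE.
      have -> : i = s by apply/val_inj.
      by rewrite -/a -/b tE /t; field; lra.
    by rewrite h0 // h0' // !mulr0 addr0.
  have Uw : U (x + w) by rewrite xw; exact: convex_set_line.
  have := Hg w w0 Uw; rewrite xw.
  have := convex_function_line fc Uh Uh' t0 t1.
  rewrite dotDl !dotZl => H1 H2.
  have H3 : 0 <= t * phi h + (1 - t) * phi h' by rewrite /phi; lra.
  have H4 : 0 <= b * phi h - a * phi h'.
    have -> : b * phi h - a * phi h' = (b - a) * (t * phi h + (1 - t) * phi h').
      by rewrite tE /t; field; lra.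
    by rewrite mulr_ge0 // ltW.
  rewrite ler_pdivlMr // mulrAC ler_ndivrMr // mulrC; lra.
(* Openness of [U] supplies directions with both signs of coordinate [s], so [D] is nonempty and
   bounded above. *)
have [e e0 Ue] := open_enorm Uo Ux.
have Sr r : `|r| < e -> S (r *: delta_mx 0 s).
  move=> re; split=> [i si|].
    by rewrite !mxE eqxx /= -val_eqE /= (gtn_eqF si) mulr0.
  apply: Ue; rewrite addrAC subrr add0r enormZ.
  suff -> : enorm (delta_mx 0 s : 'rV[R]_m) = 1 by rewrite mulr1.
  rewrite /enorm /dot (bigD1 s) //= big1 => [|i /negbTE si].
    by rewrite !mxE !eqxx mulr1 addr0 sqrtr1.
  by rewrite !mxE si andbF mulr0.
have dE r : (r *: (delta_mx 0 s : 'rV[R]_m)) 0 s = r.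
  by rewrite !mxE !eqxx mulr1.
have S1 : S ((e / 2) *: delta_mx 0 s) by apply: Sr; rewrite ger0_norm; lra.
have S2 : S ((- (e / 2)) *: delta_mx 0 s).
  by apply: Sr; rewrite normrN ger0_norm; lra.
pose D := [set phi h / h 0 s | h in [set h | S h /\ h 0 s < 0]].
have D_ub h : S h -> 0 < h 0 s -> ubound D (phi h / h 0 s).
  by move=> Sh hs _ [k [Sk ks] <-]; exact: S_line.
have Dsup : has_sup D.
  split.
    eexists; exists (- (e / 2) *: delta_mx 0 s); rewrite ?dE //.
    by split=> //; rewrite dE; lra.
  by eexists; apply: D_ub S1 _; rewrite dE; lra.
exists (sup D) => h h0 Uh; have Sh : S h by [].
have -> : dot h (g + sup D *: delta_mx 0 s) = dot h g + sup D * h 0 s.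
  rewrite dotDr dotZr; congr (_ + _ * _).
  rewrite /dot (bigD1 s) //= big1 => [|i /negbTE si].
    by rewrite !mxE !eqxx mulr1 addr0.
  by rewrite !mxE si andbF mulr0.
suff : sup D * h 0 s <= phi h by rewrite /phi; lra.
have [hs|hs|hs] := ltgtP (h 0 s) 0.
- rewrite -ler_ndivrMr //; apply: ub_le_sup; first by case: Dsup.
  by exists h.
- rewrite -ler_pdivlMr //; apply: ge_sup; first by case: Dsup.
  exact: D_ub.
- rewrite hs mulr0; suff : dot h g <= f (x + h) - f x by rewrite /phi; lra.
  apply: Hg => // i; rewrite leq_eqVlt => /orP[/eqP si|]; last exact: h0.
  by rewrite -hs; congr (h 0 _); apply/val_inj.
Qed.

(** Starts from the zero functional on the zero subspace and extends it one coordinate at a time. *)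
Lemma subdiff_nonempty x : U x -> subdiff U f x !=set0.
Proof.
move=> Ux.
suff [g Hg] : exists g, forall h, zero_from m h -> U (x + h) ->
    dot h g <= f (x + h) - f x.
  exists g; split=> // y Uy; have := Hg (y - x).
  rewrite subrKC; apply=> // t; by rewrite leqNgt ltn_ord.
suff H s : (s <= m)%N -> exists g, forall h, zero_from s h -> U (x + h) ->
    dot h g <= f (x + h) - f x by exact: H.
elim: s => [_|s IH sm].
  exists 0 => h h0 _; have -> : h = 0 by apply/rowP => t; rewrite h0 ?mxE.
  by rewrite dot0l addr0 subrr.
have [g Hg] := IH (ltnW sm).
have [c Hc] := @subgradient_extend x g (Ordinal sm) Ux Hg.
by exists (g + c *: delta_mx 0 (Ordinal sm)).
Qed.

End Subgradient.

(** * Products of stochastic matrices and their contraction *)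

Section Transition.
Variables (R : realType) (n : nat) (A : nat -> 'M[R]_n) (eta : R).
Hypotheses (A_ge0 : forall k i j, 0 <= A k i j)
  (A_sum : forall k i, \sum_(j < n) A k i j = 1)
  (eta01 : 0 < eta < 1)
  (A_lb : forall i j k, (0 < A k i j -> eta <= A k i j) /\ eta <= A k i i).

(** The product of [A k], ..., [A (k + s - 1)], with later factors on the left. *)
Fixpoint trans k s : 'M[R]_n :=
  if s is s'.+1 then A (k + s')%N *m trans k s' else 1%:M.

Lemma transS k s i j : trans k s.+1 i j = \sum_l A (k + s)%N i l * trans k s l j.
Proof. by rewrite /= mxE. Qed.

Lemma trans_ge0 k s i j : 0 <= trans k s i j.
Proof.
elim: s i => [|s IH] i; first by rewrite /= mxE ler0n.
by rewrite transS; apply: sumr_ge0 => l _; rewrite mulr_ge0.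
Qed.

Lemma trans_sum k s i : \sum_j trans k s i j = 1.
Proof.
elim: s i => [|s IH] i.
  rewrite (bigD1 i) //= big1 => [|j /negbTE ji]; first by rewrite mxE eqxx addr0.
  by rewrite mxE eq_sym ji.
under eq_bigr => j _ do rewrite transS.
rewrite exchange_big /= -[RHS](A_sum (k + s) i); apply: eq_bigr => l _.
by rewrite -mulr_sumr IH mulr1.
Qed.

(** The agents on which the value of [j] at time [k] has weight at least [eta ^+ s] after [s] steps;
    the threshold loses one factor [eta] per step. *)
Definition reached k j s : {set 'I_n} := [set i | eta ^+ s <= trans k s i j].

Lemma reached_step k j s i l : eta <= A (k + s)%N i l -> l \in reached k j s ->
  i \in reached k j s.+1.
Proof.
have [eta0 _] := andP eta01.
rewrite !inE => Ail lr; rewrite transS (bigD1 l) //= exprS.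
rewrite -[leLHS]addr0; apply: lerD.
  by apply: ler_pM => //; rewrite ltW // exprn_gt0.
by apply: sumr_ge0 => h _; rewrite mulr_ge0 // trans_ge0.
Qed.

(** Diagonal weights are at least [eta], so a reached agent stays reached. *)
Lemma reached_mono k j s t : (s <= t)%N -> reached k j s \subset reached k j t.
Proof.
move=> /subnKC <-; elim: (t - s)%N => [|d IH]; first by rewrite addn0.
apply: (fintype.subset_trans IH); apply/fintype.subsetP => i; rewrite addnS.
by apply: reached_step; have [] := A_lb i i (k + (s + d))%N.
Qed.

(** A set that does not grow over a window is closed under the edges of the union graph; as it
    contains [j], strong connectivity makes it everything. *)
Lemma reached_grow B k j s : (forall k, strongly_connected (union_edge A k B)) ->
  reached k j s != finset.setT -> reached k j s \proper reached k j (s + B).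
Proof.
move=> sc; apply: contraR; rewrite properE reached_mono ?leq_addr //= negbK => sub.
(* The edge occurs at some time [k + s + b] with [b < B]; [i] is still reached then, so [l] is
   reached after [s + b + 1 <= s + B] steps, and [sub] brings it back. *)
have step i l : i \in reached k j s -> union_edge A (k + s) B i l ->
    l \in reached k j s.
  move=> ir /existsP[b]; rewrite /edge => Ali; apply: (fintype.subsetP sub).
  have [/(_ Ali) H _] := A_lb l i (k + s + b)%N.
  apply: (fintype.subsetP (@reached_mono k j (s + b).+1 _ _)).
    by rewrite -addnS leq_add2l.
  apply: reached_step (fintype.subsetP (@reached_mono k j s _ (leq_addr _ _)) _ ir).
  by rewrite addnA.
have jr : j \in reached k j s.
  apply: (fintype.subsetP (@reached_mono k j 0 _ (leq0n _))).
  by rewrite inE /= mxE eqxx.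
apply/eqP/setP => i; rewrite [RHS]inE.
have [<-//|ji] := eqVneq j i.
have /connectP[p pp ->] := sc (k + s)%N j i ji.
move: (reached k j s) step jr pp => S step.
elim: p (j) => //= l p IH h hS /andP[hl]; apply: IH.
exact: step hl.
Qed.

(** The reached set contains [j] at the start and gains an agent in each window of length [B] until
    it is full, so [n] windows suffice. *)
Lemma trans_lb B k i j : (forall k, strongly_connected (union_edge A k B)) ->
  eta ^+ (n * B) <= trans k (n * B) i j.
Proof.
move=> sc.
have H t : (reached k j (t * B) == finset.setT) || (t < #|reached k j (t * B)|)%N.
  elim: t => [|t IH].
    apply/orP; right; apply/card_gt0P; exists j.
    by rewrite inE /= mxE eqxx.
  have [E|NE] := eqVneq (reached k j (t * B)) finset.setT.
    by rewrite -finset.subTset -E reached_mono // mulSn leq_addl.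
  move: IH; rewrite (negbTE NE) /= => IH; apply/orP; right.
  rewrite mulSnr; apply: leq_ltn_trans IH _.
  exact: proper_card (reached_grow sc NE).
have /orP[/eqP E|] := H n; last first.
  by have := max_card (mem (reached k j (n * B))); rewrite card_ord leqNgt => /negbTE ->.
have : i \in reached k j (n * B) by rewrite E inE.
by rewrite inE.
Qed.

(** Row-stochastic averaging does not amplify earlier errors, so they simply add up. *)
Lemma trans_scalar (y : nat -> 'I_n -> R) (c : nat -> R) k s i :
  (forall k i, y k.+1 i <= \sum_j A k i j * y k j + c k) ->
  y (k + s)%N i <= \sum_j trans k s i j * y k j + \sum_(r < s) c (k + r)%N.
Proof.
move=> H; elim: s i => [|s IH] i.
  rewrite addn0 big_ord0 addr0 (bigD1 i) //= big1 => [|j /negbTE ji].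
    by rewrite mxE eqxx mul1r addr0.
  by rewrite mxE eq_sym ji mul0r.
rewrite addnS big_ord_recr /= addrA; apply: le_trans (H _ _) _; rewrite lerD2r.
apply: le_trans (ler_sum _ (fun j _ => ler_wpM2l (A_ge0 (k + s) i j) (IH j))) _.
under [leLHS]eq_bigr => j _ do rewrite mulrDr mulr_sumr.
rewrite big_split /= -mulr_suml A_sum mul1r lerD2r exchange_big /= ler_sum // => j _.
by rewrite mxE mulr_suml; under eq_bigr => l _ do rewrite mulrA.
Qed.

Lemma trans_vector m (x : nat -> 'I_n -> 'rV[R]_m) (c : nat -> R) k s i :
  (forall k i, enorm (x k.+1 i - \sum_j A k i j *: x k j) <= c k) ->
  enorm (x (k + s)%N i - \sum_j trans k s i j *: x k j)
    <= \sum_(r < s) c (k + r)%N.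
Proof.
move=> H; elim: s i => [|s IH] i.
  rewrite addn0 big_ord0 (bigD1 i) //= big1 => [|j /negbTE ji].
    by rewrite mxE eqxx scale1r addr0 subrr enorm0.
  by rewrite mxE eq_sym ji scale0r.
rewrite addnS big_ord_recr /=.
apply: le_trans (enorm_triangle _ _ (\sum_j A (k + s)%N i j *: x (k + s)%N j)) _.
rewrite [leLHS]addrC; apply: lerD _ (H _ _).
have := enorm_wsum (A_ge0 (k + s)%N i) IH; rewrite A_sum mul1r.
apply: le_trans; rewrite le_eqVlt; apply/orP; left; apply/eqP; congr enorm.
under [RHS]eq_bigr => j _ do rewrite scalerBr scaler_sumr.
rewrite sumrB exchange_big /=; congr (_ - _); apply: eq_bigr => j _.
by rewrite mxE scaler_suml; apply: eq_bigr => l _; rewrite scalerA.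
Qed.

End Transition.

(* Cancel the common mass delta at j0: the remainders of p and q both have mass
   1 - delta, and their difference averages the vectors w i - w j. *)
Lemma stochastic_contraction (R : realType) (n m : nat) (p q : 'I_n -> R)
    (w : 'I_n -> 'rV[R]_m) (D delta : R) j0 :
  (forall i, 0 <= p i) -> (forall i, 0 <= q i) ->
  \sum_i p i = 1 -> \sum_i q i = 1 -> delta < 1 ->
  delta <= p j0 -> delta <= q j0 -> (forall i j, enorm (w i - w j) <= D) ->
  enorm (\sum_i p i *: w i - \sum_i q i *: w i) <= (1 - delta) * D.
Proof.
move=> p0 q0 p1 q1 d1 dp dq wD; have dd : 0 < 1 - delta by lra.
pose e i : R := if i == j0 then delta else 0.
have eS : \sum_i e i = delta by rewrite /e -big_mkcond big_pred1_eq.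
pose p' i := p i - e i; pose q' i := q i - e i.
have p'0 i : 0 <= p' i by rewrite /p' /e; case: eqP => [->|_]; rewrite ?subr0 // subr_ge0.
have q'0 i : 0 <= q' i by rewrite /q' /e; case: eqP => [->|_]; rewrite ?subr0 // subr_ge0.
have p'1 : \sum_i p' i = 1 - delta by rewrite sumrB p1 eS.
have q'1 : \sum_i q' i = 1 - delta by rewrite sumrB q1 eS.
have -> : \sum_i p i *: w i - \sum_i q i *: w i =
    \sum_i p' i *: w i - \sum_i q' i *: w i.
  rewrite -!sumrB; apply: eq_bigr => i _.
  by rewrite -!scalerBl; congr (_ *: _); rewrite /p' /q'; ring.
(* After multiplication by [1 - delta], both remainders are marginals of the product weights
   [p' i * q' j], whose total mass is the square of [1 - delta]. *)
rewrite -(ler_pM2l dd) -{1}(ger0_norm (ltW dd)) -enormZ mulrA.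
have E : (1 - delta) * (1 - delta) = \sum_(ij : 'I_n * 'I_n) p' ij.1 * q' ij.2.
  rewrite -{1}p'1 -q'1 mulr_suml.
  under eq_bigr => i _ do rewrite mulr_sumr.
  by rewrite pair_bigA.
rewrite E.
have -> : (1 - delta) *: (\sum_i p' i *: w i - \sum_i q' i *: w i) =
    \sum_(ij : 'I_n * 'I_n) (p' ij.1 * q' ij.2) *: (w ij.1 - w ij.2).
  rewrite -(pair_bigA _ (fun i j => (p' i * q' j) *: (w i - w j))) /=.
  under [RHS]eq_bigr => i _ do under eq_bigr => j _ do rewrite scalerBr.
  under [RHS]eq_bigr => i _ do rewrite sumrB.
  rewrite sumrB scalerBr; congr (_ - _).
    rewrite -q'1 scaler_sumr; apply: eq_bigr => i _.
    by rewrite scalerA -scaler_suml -mulr_sumr mulrC.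
  rewrite exchange_big /= -p'1 scaler_sumr; apply: eq_bigr => i _.
  by rewrite scalerA -scaler_suml -mulr_suml.
apply: enorm_wsum => ij //; exact: mulr_ge0.
Qed.

(** Beyond some [N] the recursion is iterated along each residue class modulo [T], where it is a
    perturbed geometric decay. *)
Lemma contraction_cvg0 (R : realType) (D g : nat -> R) (q : R) (T : nat) :
  (forall k, 0 <= D k) -> 0 <= q < 1 -> (0 < T)%N ->
  (forall e, 0 < e -> exists N, forall k, (N <= k)%N -> g k < e) ->
  (forall k, D (k + T)%N <= q * D k + g k) ->
  forall e, 0 < e -> exists N, forall k, (N <= k)%N -> D k < e.
Proof.
move=> D0 /andP[q0 q1] T0 g0 Dq e e0.
(* With this bound on [g], the level [e / 2] is the fixed point of the recursion. *)
have [|N gN] := g0 ((1 - q) * (e / 2)); first by rewrite mulr_gt0 // ?divr_gt0 // subr_gt0.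
pose M := \sum_(r < T) D (N + r)%N.
have M0 : 0 <= M by apply: sumr_ge0.
have DM r t : (r < T)%N -> D (N + r + t * T)%N <= q ^+ t * M + e / 2.
  move=> rT; elim: t => [|t IH].
    rewrite mul0n addn0 expr0 mul1r /M (bigD1 (Ordinal rT)) //= -addrA lerDl.
    by rewrite addr_ge0 ?sumr_ge0 // divr_ge0 // ltW.
  rewrite mulSnr addnA; apply: le_trans (Dq _) _.
  have := ler_wpM2l q0 IH; have := gN (N + r + t * T)%N; rewrite exprS -addnA leq_addr.
  move=> /(_ isT); lra.
have [t0 Ht0] : exists t0, forall t, (t0 <= t)%N -> q ^+ t * M < e / 2.
  have : (fun t => q ^+ t * M) @ \oo --> (0 * M).
    by apply: cvgMr_tmp; apply: cvg_expr; rewrite ger0_norm.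
  rewrite mul0r => /cvgrPdist_lt /(_ (e / 2)); rewrite divr_gt0 // => /(_ isT)[t0 _ H].
  exists t0 => t /H /=; rewrite sub0r normrN; exact: le_lt_trans (ler_norm _).
exists (N + t0 * T)%N => k Nk.
have -> : k = (N + (k - N) %% T + (k - N) %/ T * T)%N.
  by rewrite addnAC -addnA -divn_eq; lia.
apply: le_lt_trans (DM _ _ _) _; first by rewrite ltn_mod.
have : (t0 <= (k - N) %/ T)%N by rewrite leq_divRL //; lia.
by move=> /Ht0; lra.
Qed.

(** * Series of real numbers *)

Section RealSequences.
Variable R : realType.

Lemma bounded_series_tail (a : nat -> R) (C : R) :
  (forall k, 0 <= a k) -> (forall N, \sum_(k < N) a k <= C) ->
  forall e, 0 < e -> exists N, forall k s, (N <= k)%N -> \sum_(r < s) a (k + r)%N < e.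
Proof.
move=> a0 aC e e0; pose S := [set \sum_(k < N) a k | N in [set: nat]].
have Ssup : has_sup S.
  by split; [exists 0, 0%N; rewrite ?big_ord0|exists C => _ [N _ <-]].
have [_ [N _ <-] HN] := sup_adherent e0 Ssup.
exists N => k s Nk.
have : \sum_(r < k + s) a r <= sup S by apply: ub_le_sup; [case: Ssup|exists (k + s)%N].
rewrite big_split_ord /=.
suff : \sum_(r < N) a r <= \sum_(r < k) a r by lra.
by rewrite -(subnKC Nk) big_split_ord /= lerDl sumr_ge0.
Qed.

Lemma bounded_series_shift (a : nat -> R) (C : R) :
  (forall k, 0 <= a k) -> (forall N, \sum_(k < N) a k <= C) ->
  forall s N, \sum_(k < N) a (s + k)%N <= C.
Proof.
move=> a0 aC s N; apply: le_trans (aC (s + N)%N).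
by rewrite big_split_ord /= lerDr sumr_ge0.
Qed.

(** Sums decrements over overlapping windows: for nonnegative [M] the result is at most the sum of
    the first [P] terms. *)
Lemma lag_telescope (M : nat -> R) (P N : nat) :
  \sum_(r < N) (M r - M (r + P)%N)
    = \sum_(r < P) M r - \sum_(r < P) M (N + r)%N.
Proof.
elim: N => [|N IH].
  by rewrite big_ord0 subrr.
rewrite big_ord_recr /= IH.
have : \sum_(r < P.+1) M (N + r)%N = \sum_(r < P.+1) M (N + r)%N by [].
rewrite {1}big_ord_recl big_ord_recr /= addn0.
under eq_bigr => i _ do rewrite /bump /= add1n -addSnnS.
lra.
Qed.

(** If [G] stayed above [e], the weighted sum would dominate [e] times a divergent series. *)
Lemma divergent_weights_liminf (a G : nat -> R) (K : R) :
  (forall k, 0 < a k) -> (forall k, 0 <= G k) ->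
  (forall b, exists N, b <= \sum_(k < N) a k) ->
  (forall N, \sum_(k < N) a k * G k <= K) ->
  forall e, 0 < e -> forall N, exists2 k, (N <= k)%N & G k < e.
Proof.
move=> a0 G0 adiv GK e e0 N; apply: contrapT => H.
have Ge k : (N <= k)%N -> e <= G k.
  by move=> Nk; rewrite leNgt; apply/negP => Gk; apply: H; exists k.
have [N' HN'] := adiv (K / e + 1 + \sum_(k < N) a k).
have := GK (N + N')%N; rewrite big_split_ord /=.
have : \sum_(k < N) a k + \sum_(k < N') a (N + k)%N >= \sum_(k < N') a k.
  rewrite -(big_split_ord _ (fun k => true) (fun k : 'I_(N + N') => a k)) /=.
  rewrite addnC big_split_ord /= lerDl.
  by apply: sumr_ge0 => k _; exact: ltW.
have : 0 <= \sum_(k < N) a k * G k.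
  by apply: sumr_ge0 => k _; rewrite mulr_ge0 // ltW.
have : \sum_(k < N') a (N + k)%N * e <= \sum_(k < N') a (N + k)%N * G (N + k)%N.
  by apply: ler_sum => k _; rewrite ler_wpM2l ?Ge ?leq_addr // ltW.
rewrite -mulr_suml => H1 H2 H3 H4.
have : K + e <= (\sum_(k < N') a (N + k)%N) * e.
  by rewrite -ler_pdivrMr // mulrDl divff ?gt_eqF //; lra.
lra.
Qed.

End RealSequences.

(** * Consensus under vanishing perturbations *)

Section Consensus.
Variables (R : realType) (m n : nat) (A : nat -> 'M[R]_n).
Hypotheses (A_rule : weight_rule A) (A_conn : UJSC A).

(** Over [T = n * B] steps the largest pairwise distance shrinks by the factor [1 - eta ^+ T], up to
    twice the errors accumulated in the window. *)
Lemma consensus (x : nat -> 'I_n -> 'rV[R]_m) (c : nat -> R) :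
  (forall k i, enorm (x k.+1 i - \sum_j A k i j *: x k j) <= c k) ->
  (forall e, 0 < e -> exists N, forall k, (N <= k)%N -> c k < e) ->
  forall e, 0 < e -> exists N, forall k, (N <= k)%N ->
    forall i j, enorm (x k i - x k j) < e.
Proof.
move=> xc c0 e e0.
have [A_ge0 A_sum [eta eta01 A_lb]] := A_rule; have [B B0 sc] := A_conn.
case: (posnP n) => [n0|n0].
  by exists 0%N => k _ i; have := ltn_ord i; lia.
pose T := (n * B)%N; have T0 : (0 < T)%N by rewrite muln_gt0 n0.
have [eta0 eta1] := andP eta01.
have d0 : 0 < eta ^+ T by rewrite exprn_gt0.
have d1 : eta ^+ T < 1 by rewrite exprn_ilt1 // -?lt0n // ltW.
pose D k := \big[Num.max/0]_(p : 'I_n * 'I_n) enorm (x k p.1 - x k p.2).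
have DP k i j : enorm (x k i - x k j) <= D k.
  exact: (le_bigmax _ (fun p : 'I_n * 'I_n => enorm (x k p.1 - x k p.2)) (i, j)).
have D0 k : 0 <= D k by apply: bigmax_ge_id.
pose j0 := Ordinal n0.
have q01 : 0 <= 1 - eta ^+ T < 1 by lra.
have [||N HN] := @contraction_cvg0 R D
    (fun k => 2 * \sum_(r < T) c (k + r)%N) (1 - eta ^+ T) T D0 q01 T0 _ _ e e0.
- move=> e' e'0.
  have [|N HN] := c0 (e' / 2 / T.+1%:R); first by rewrite !divr_gt0.
  exists N => k Nk.
  have : \sum_(r < T) c (k + r)%N <= \sum_(r < T) e' / 2 / T.+1%:R.
    by apply: ler_sum => r _; apply/ltW/HN; rewrite (leq_trans Nk) // leq_addr.
  rewrite sumr_const card_ord -[leRHS]mulr_natr -mulrA => H1.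
  have : T.+1%:R^-1 * T%:R < 1 :> R by rewrite mulrC ltr_pdivrMr // mul1r ltr_nat.
  rewrite -(@ltr_pM2l _ (e' / 2)) ?divr_gt0 // mulr1.
  by move: (_ * (_^-1 * _)) H1 => h; lra.
- move=> k; apply/bigmax_leP; split=> [|[i j] _ /=].
    rewrite addr_ge0 ?mulr_ge0 ?sumr_ge0 // => [|r _]; first by lra.
    exact: le_trans (enorm_ge0 _) (xc _ j0).
  have H i' := @trans_vector R n A A_ge0 A_sum m x c k T i' xc.
  have := @stochastic_contraction R n m (trans A k T i) (trans A k T j) (x k) (D k)
    (eta ^+ T) j0 (trans_ge0 A_ge0 k T i) (trans_ge0 A_ge0 k T j)
    (trans_sum A_sum k T i) (trans_sum A_sum k T j) d1
    (trans_lb A_ge0 eta01 A_lb k i j0 sc) (trans_lb A_ge0 eta01 A_lb k j j0 sc) (DP k).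
  have := enorm_triangle (x (k + T)%N i) (x (k + T)%N j) (\sum_l trans A k T i l *: x k l).
  have := enorm_triangle (\sum_l trans A k T i l *: x k l) (x (k + T)%N j)
     (\sum_l trans A k T j l *: x k l).
  have := H i; have := H j; rewrite (enorm_distC (x (k + T)%N j)); lra.
- by exists N => k Nk i j; apply: le_lt_trans (DP k i j) (HN k Nk).
Qed.

End Consensus.

(** * A common minimiser implies convergence *)

Section Sufficiency.
Variables (R : realType) (m n : nat) (X : set 'rV[R]_m) (U : 'I_n -> set 'rV[R]_m).
Variables (f : 'I_n -> 'rV[R]_m -> R) (L : R) (alpha : nat -> R).
Hypotheses (X0 : X !=set0) (Xc : closed X) (Xv : convex_set X)
  (XU : forall i, X `<=` U i) (Uo : forall i, open (U i))
  (Uv : forall i, convex_set (U i)) (fv : forall i, convex_function (U i) (f i))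
  (L0 : 0 < L)
  (fL : forall i x d, X x -> subdiff (U i) (f i) x d -> enorm d <= L)
  (alpha0 : forall k, 0 < alpha k).

(** Nonexpansiveness removes the projection; the cross term of the expanded square is bounded by the
    subgradient inequality at [z], the last term by [L]. *)
Lemma subgradient_step i (v d z : 'rV[R]_m) (a : R) : 0 < a -> X v ->
  subdiff (U i) (f i) v d -> X z ->
  dot (Defs.proj X (v - a *: d) - z) (Defs.proj X (v - a *: d) - z)
    <= dot (v - z) (v - z) - 2 * a * (f i v - f i z) + L ^+ 2 * a ^+ 2.
Proof.
move=> a0 Xv' vd Xz; apply: le_trans (proj_nonexp X0 Xc Xv _ Xz) _.
have := fL Xv' vd; have [_ /(_ z (@XU i _ Xz))] := vd; rewrite le_enormP ?(ltW L0) //.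
have -> : v - a *: d - z = (v - z) - a *: d by rewrite addrAC.
rewrite -(opprB v z) dotNl; move: (v - z) => w.
rewrite !(dotDl, dotDr, dotNl, dotNr, dotZl, dotZr) (dotC d w) => H1 H2.
have : a ^+ 2 * dot d d <= a ^+ 2 * L ^+ 2 by rewrite ler_wpM2l ?sqr_ge0.
have : a * (f i v - f i z) <= a * dot w d by rewrite ler_wpM2l ?(ltW a0) //; lra.
rewrite !expr2; lra.
Qed.

Lemma subgradient_step_move i (v d : 'rV[R]_m) (a : R) : 0 < a -> X v ->
  subdiff (U i) (f i) v d -> enorm (Defs.proj X (v - a *: d) - v) <= L * a.
Proof.
move=> a0 Xv' vd; rewrite le_enormP ?mulr_ge0 ?(ltW L0) ?(ltW a0) // exprMn.
by have := subgradient_step a0 Xv' vd Xv'; rewrite !subrr mulr0 dot0l; lra.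
Qed.

(** A subgradient at [z] exists and has norm at most [L]; this provides the continuity needed to
    pass to limits. *)
Lemma subgradient_lsc i (y z : 'rV[R]_m) : X y -> X z ->
  f i z <= f i y + L * enorm (y - z).
Proof.
move=> Xy Xz; have [g gd] := subdiff_nonempty (@Uo i) (@Uv i) (@fv i) (@XU i _ Xz).
have gL := fL Xz gd; have [_ /(_ y (@XU i _ Xy))] := gd.
have := dot_le (z - y) g; rewrite -(opprB y z) dotNl enormN.
have := ler_wpM2l (enorm_ge0 (y - z)) gL; lra.
Qed.

Section Run.
Variables (A : nat -> 'M[R]_n) (C : R).
Hypotheses (A_rule : weight_rule A) (A_conn : UJSC A)
  (alpha_div : forall b, exists N, b <= \sum_(k < N) alpha k)
  (alpha_sq : forall N, \sum_(k < N) alpha k ^+ 2 <= C).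
Variables (x v d : nat -> 'I_n -> 'rV[R]_m).
Hypotheses (gen : generated X U f alpha A x v d) (xX : forall k i, X (x k i)).

Let A_ge0 k i j : 0 <= A k i j. Proof. by case: A_rule. Qed.
Let A_sum k i : \sum_j A k i j = 1. Proof. by case: A_rule. Qed.

Let vX k i : X (v k i).
Proof. by have [-> _ _] := gen k i; exact: convex_set_sum. Qed.

Lemma stepsize_small e : 0 < e -> exists N, forall k, (N <= k)%N -> L * alpha k < e.
Proof.
move=> e0; have e1 : 0 < (e / L) ^+ 2 by rewrite exprn_gt0 // divr_gt0.
have [N HN] := bounded_series_tail (fun k => sqr_ge0 (alpha k)) alpha_sq e1.
exists N => k Nk; have := HN k 1 Nk; rewrite big_ord1 addn0.
rewrite ltr_sqr ?nnegrE ?(ltW (alpha0 _)) ?divr_ge0 ?(ltW e0) ?(ltW L0) //.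
by rewrite ltr_pdivlMr // mulrC.
Qed.

Lemma run_consensus e : 0 < e -> exists N, forall k, (N <= k)%N ->
  forall i j, enorm (x k i - x k j) < e.
Proof.
apply: (consensus A_rule A_conn _ stepsize_small) => k i.
by have [<- vd ->] := gen k i; exact: subgradient_step_move (alpha0 k) (vX k i) vd.
Qed.

Let c k := L ^+ 2 * alpha k ^+ 2.

Let c_ge0 k : 0 <= c k. Proof. by rewrite mulr_ge0 ?sqr_ge0. Qed.

Let c_sum N : \sum_(k < N) c k <= L ^+ 2 * C.
Proof. by rewrite -mulr_sumr ler_wpM2l ?sqr_ge0. Qed.

Variable z : 'rV[R]_m.
Hypotheses (zX : X z) (z_min : forall i y, X y -> f i z <= f i y).

Let y k i := dot (x k i - z) (x k i - z).

Lemma run_descent k i :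
  y k.+1 i <= \sum_j A k i j * y k j + c k - 2 * alpha k * (f i (v k i) - f i z).
Proof.
have [vE vd xE] := gen k i; rewrite /y xE.
have := subgradient_step (alpha0 k) (vX k i) vd zX.
have := dot_wsum (x k) z (A_ge0 k i) (A_sum k i); rewrite -vE /c; lra.
Qed.

Lemma run_quasi_descent k i : y k.+1 i <= \sum_j A k i j * y k j + c k.
Proof.
have := run_descent k i; have := z_min i (vX k i); have := alpha0 k => a0 fz.
have : 0 <= 2 * alpha k * (f i (v k i) - f i z) by rewrite !mulr_ge0 ?(ltW a0) ?subr_ge0.
lra.
Qed.

Lemma run_quasi_monotone k s M : (forall i, y k i <= M) ->
  forall i, y (k + s)%N i <= M + \sum_(r < s) c (k + r)%N.
Proof.
move=> yM i; apply: le_trans (trans_scalar A_ge0 A_sum k s i run_quasi_descent) _.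
rewrite lerD2r -[leRHS]mul1r -(trans_sum A_sum k s i) mulr_suml.
by apply: ler_sum => j _; rewrite ler_wpM2l // trans_ge0.
Qed.

(** The decrease [b k] of agent [i] reaches every agent with weight at least [delta] within [T]
    further steps, hence lowers the maximum. The window has length [P = T + 1]: one step for the
    decrease and [T] for its spread. *)
Lemma run_suboptimality_sum i :
  exists K, forall N, \sum_(k < N) alpha k * (f i (v k i) - f i z) <= K.
Proof.
have [_ _ [eta eta01 A_lb]] := A_rule; have [B B0 sc] := A_conn.
pose T := (n * B)%N; pose P := T.+1; set delta := eta ^+ T.
have delta0 : 0 < delta by rewrite exprn_gt0 //; case/andP: eta01.
pose b k := 2 * alpha k * (f i (v k i) - f i z).
have b0 k : 0 <= b k by rewrite !mulr_ge0 ?(ltW (alpha0 k)) // subr_ge0 z_min.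
pose M k := \big[Num.max/0]_j y k j.
have yM k j : y k j <= M k by exact: (le_bigmax _ (y k)).
have M0 k : 0 <= M k by exact: bigmax_ge_id.
have AM k j : \sum_l A k j l * y k l <= M k.
  rewrite -[leRHS]mul1r -(A_sum k j) mulr_suml.
  by apply: ler_sum => l _; rewrite ler_wpM2l.
have window k : delta * b k <= M k - M (k + P)%N + \sum_(s < P) c (k + s)%N.
  suff H j : y (k + P)%N j <= M k + \sum_(s < P) c (k + s)%N - delta * b k.
    suff : M (k + P)%N <= M k + \sum_(s < P) c (k + s)%N - delta * b k by lra.
    apply/bigmax_leP; split=> //; apply: le_trans (H i); exact: dot_ge0.
  rewrite big_ord_recl addn0 -addSnnS.
  apply: le_trans (trans_scalar A_ge0 A_sum k.+1 T j run_quasi_descent) _.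
  have -> : \sum_(s < T) c (k + lift ord0 s)%N = \sum_(s < T) c (k.+1 + s)%N.
    by apply: eq_bigr => s _; rewrite /= /bump leq0n add1n addnS.
  suff : \sum_l trans A k.+1 T j l * y k.+1 l <= M k + c k - delta * b k by lra.
  have Hl l : y k.+1 l <= M k + c k by have := run_quasi_descent k l; have := AM k l; lra.
  have Hi : y k.+1 i <= M k + c k - b k.
    by have := run_descent k i; have := AM k i; rewrite /b; lra.
  have tlb : delta <= trans A k.+1 T j i by exact: (trans_lb A_ge0 eta01 A_lb k.+1 j i sc).
  have -> : M k + c k = \sum_l trans A k.+1 T j l * (M k + c k).
    by rewrite -mulr_suml (trans_sum A_sum) mul1r.
  rewrite (bigD1 i) //= [in leRHS](bigD1 i) //=.
  have : \sum_(l | l != i) trans A k.+1 T j l * y k.+1 l <=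
      \sum_(l | l != i) trans A k.+1 T j l * (M k + c k).
    by apply: ler_sum => l _; rewrite ler_wpM2l // trans_ge0.
  have := ler_wpM2l (trans_ge0 A_ge0 k.+1 T j i) Hi.
  have := ler_wpM2r (b0 k) tlb; lra.
(* The first [P] maxima remain from the telescoping, each of the [P] shifts of the error series
   costs at most [L ^+ 2 * C], and the factor 2 comes from [b]. *)
exists ((\sum_(r < P) M r + P%:R * (L ^+ 2 * C)) / delta / 2) => N.
rewrite !ler_pdivlMr // !mulr_suml.
have -> : \sum_(k < N) alpha k * (f i (v k i) - f i z) * 2 * delta = \sum_(k < N) delta * b k.
  by apply: eq_bigr => k _; rewrite /b; ring.
apply: le_trans (ler_sum _ (fun (k : 'I_N) _ => window k)) _.
rewrite big_split /= lag_telescope; apply: lerD.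
  by rewrite lerBlDr lerDl sumr_ge0.
rewrite exchange_big /= mulr_natl -[P in leRHS]card_ord -sumr_const.
apply: ler_sum => s _; under eq_bigr => k _ do rewrite addnC.
exact: bounded_series_shift c_ge0 c_sum _ _.
Qed.

Lemma run_bounded : exists M, forall k i, enorm (x k i) <= M.
Proof.
pose M := \sum_i y 0 i + L ^+ 2 * C.
have yM k i : y k i <= M.
  have y0 j : y 0 j <= \sum_i y 0 i.
    by rewrite (bigD1 j) //= lerDl sumr_ge0 // => l _; exact: dot_ge0.
  by have := run_quasi_monotone k y0 i; rewrite add0n => /le_trans; apply; rewrite lerD2l c_sum.
exists (Num.sqrt M + enorm z) => k i.
have := enormD (x k i - z) z; rewrite subrK => /le_trans; apply.
by rewrite lerD2r; apply: ler_wsqrtr; exact: yM.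
Qed.

End Run.

Lemma run_converges (A : nat -> 'M[R]_n) (C : R) (x v d : nat -> 'I_n -> 'rV[R]_m) z :
  weight_rule A -> UJSC A ->
  (forall b, exists N, b <= \sum_(k < N) alpha k) ->
  (forall N, \sum_(k < N) alpha k ^+ 2 <= C) ->
  generated X U f alpha A x v d -> (forall k i, X (x k i)) ->
  X z -> (forall i y, X y -> f i z <= f i y) ->
  exists w, [/\ X w, forall i y, X y -> f i w <= f i y &
    forall e, 0 < e -> exists N, forall k, (N <= k)%N ->
      forall i, enorm (x k i - w) < e].
Proof.
move=> A_rule A_conn alpha_div alpha_sq gen xX zX z_min.
case: (posnP n) => [n0|n0].
  exists z; split=> // e e0; exists 0%N => k _ i; have := ltn_ord i; lia.
have vX k i : X (v k i).
  by have [-> _ _] := gen k i; have [? ? _] := A_rule; exact: convex_set_sum.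
pose i0 := Ordinal n0.
have cons := run_consensus A_rule A_conn alpha_sq gen xX.
have [M xM] := run_bounded A_rule alpha_sq gen xX zX z_min.
pose G k := \sum_i (f i (v k i) - f i z).
have Gi_ge0 k i : 0 <= f i (v k i) - f i z by rewrite subr_ge0 z_min.
have G_ge0 k : 0 <= G k by apply: sumr_ge0.
have [K GK] : exists K, forall N, \sum_(k < N) alpha k * G k <= K.
  have [K HK] := choice (run_suboptimality_sum A_rule A_conn alpha_sq gen xX zX z_min).
  exists (\sum_i K i) => N; under eq_bigr => k _ do rewrite mulr_sumr.
  by rewrite exchange_big; apply: ler_sum.
have inf := divergent_weights_liminf alpha0 G_ge0 alpha_div GK.
(* Times at which the total suboptimality is below [1 / (N + 1)]; a cluster point of agent [i0]
   along them serves, by consensus, for all agents. *)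
have /choice[phi Hphi] (N : nat) : exists k, (N <= k)%N /\ G k < N.+1%:R^-1.
  have [|k Nk Gk] := inf N.+1%:R^-1 _ N; first by rewrite invr_gt0.
  by exists k.
have [w Hw] := bounded_cluster (fun N => xM (phi N) i0).
have near e : 0 < e -> forall N, exists2 k, (N <= k)%N &
    G k < e /\ forall i, enorm (x k i - w) < e.
  move=> e0 N; have e2 : 0 < e / 2 by rewrite divr_gt0.
  have [N1 HN1] := cons _ e2; have [N2 HN2] := invS_lt e0.
  have [l Nl Hl] := Hw _ e2 (maxn N (maxn N1 N2)).
  have [lp Gl] := Hphi l.
  exists (phi l); first by lia.
  split=> [|i].
    apply: lt_trans Gl _; apply: le_lt_trans HN2.
    by rewrite lef_pV2 ?posrE // ler_nat; lia.
  have := enorm_triangle (x (phi l) i) w (x (phi l) i0).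
  by have /(_ i i0) := HN1 (phi l) ltac:(lia); lra.
have wX : X w.
  apply: closed_enorm => // e e0; have [k _ [_ /(_ i0) H]] := near e e0 0.
  by exists (x k i0) => //; exact: ltW.
(* At precision [e / (1 + L)], the suboptimality at [v k i] and the Lipschitz error from [v k i] to
   [w] add up to at most [e]. *)
have w_min i u : X u -> f i w <= f i u.
  move=> Xu; apply: le_trans (z_min i u Xu); apply/ler_addgt0Pr => e e0.
  have e1 : 0 < e / (1 + L) by rewrite divr_gt0 // addr_gt0.
  have [k _ [Gk xk]] := near _ e1 0.
  have fG : f i (v k i) - f i z <= G k.
    by rewrite /G (bigD1 i) //= lerDl sumr_ge0.
  have vw : enorm (v k i - w) <= e / (1 + L).
    have [-> _ _] := gen k i; have [A0 A1 _] := A_rule.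
    have := enorm_wsum (A0 k i) (fun j => ltW (xk j)); rewrite A1 mul1r.
    under eq_bigr => j _ do rewrite scalerBr.
    by rewrite sumrB -scaler_suml A1 scale1r.
  have := subgradient_lsc i (vX k i) wX.
  have := ler_wpM2l (ltW L0) vw.
  have : e / (1 + L) + L * (e / (1 + L)) = e.
    by rewrite -{1}[e / _]mul1r -mulrDl mulrC divfK // gt_eqF // addr_gt0.
  lra.
(* Now [w] is the reference point: from a time when all agents are within [e / 2] of [w], squared
   distances stay below [e ^+ 2 / 4 + e ^+ 2 / 2]. *)
exists w; split=> // e e0; have e2 : 0 < e ^+ 2 / 2 by rewrite divr_gt0 // exprn_gt0.
have c0 k : 0 <= L ^+ 2 * alpha k ^+ 2 by rewrite mulr_ge0 ?sqr_ge0.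
have cC N : \sum_(k < N) L ^+ 2 * alpha k ^+ 2 <= L ^+ 2 * C.
  by rewrite -mulr_sumr ler_wpM2l ?sqr_ge0.
have [N HN] := bounded_series_tail c0 cC e2.
have e3 : 0 < e / 2 by rewrite divr_gt0.
have [k0 Nk0 [_ xk0]] := near _ e3 N.
exists k0 => k k0k i.
have yk0 j : dot (x k0 j - w) (x k0 j - w) <= (e / 2) ^+ 2.
  by rewrite -le_enormP ltW.
have := run_quasi_monotone A_rule gen xX wX w_min (k - k0) yk0 i.
rewrite subnKC // -sqr_enorm => H.
rewrite -ltr_sqr ?nnegrE ?enorm_ge0 ?(ltW e0) //; apply: le_lt_trans H _.
by have := HN k0 (k - k0)%N Nk0; lra.
Qed.

End Sufficiency.

(** * Epochs measured by accumulated stepsize *)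

Section Epochs.
Variables (R : realType) (alpha : nat -> R).
Hypotheses (alpha0 : forall k, 0 < alpha k)
  (alpha_div : forall b, exists N, b <= \sum_(k < N) alpha k)
  (alpha_small : forall e, 0 < e -> exists N, forall k, (N <= k)%N -> alpha k < e).

Let S k := \sum_(r < k) alpha r.

Let S_mono k s : (k <= s)%N -> S k <= S s.
Proof.
move=> ks; rewrite /S -(subnKC ks) big_split_ord /= lerDl.
by apply: sumr_ge0 => r _; exact: ltW.
Qed.

Lemma cyclic_epochs n i0 : (i0 < n)%N -> forall N, exists p s,
  [/\ (N <= p)%N, forall r, (r < s)%N -> (Num.truncn (S (p + r)) %% n)%N = i0 &
    1 / 2 <= \sum_(r < s) alpha (p + r)%N].
Proof.
move=> i0n N.
have [|N0 HN0] := alpha_small (_ : 0 < 1 / 2); first by rewrite divr_gt0.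
(* [Q] is congruent to [i0] modulo [n] and exceeds [S N1], which forces the epoch to start after
   [N1]. *)
pose N1 := maxn N N0; pose Q := ((Num.truncn (S N1)).+1 * n + i0)%N.
have SQ : S N1 < Q%:R.
  apply: lt_le_trans (truncnS_gt _) _; rewrite ler_nat.
  by rewrite (leq_trans _ (leq_addr _ _)) // leq_pmulr //; lia.
have [N2 HN2] := alpha_div Q%:R; have [N3 HN3] := alpha_div Q.+1%:R.
have exP : exists k, Q%:R <= S k by exists N2.
have exE : exists k, Q.+1%:R <= S k by exists N3.
case: (ex_minnP exP) => p Qp pmin; case: (ex_minnP exE) => e Qe emin.
have N1p : (N1 < p)%N.
  rewrite ltnNge; apply/negP => /S_mono; lra.
have pe : (p <= e)%N.
  by apply: pmin; apply: le_trans Qe; rewrite ler_nat.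
have Sp : S p < Q%:R + 1 / 2.
  have p1 : p = p.-1.+1 by lia.
  have Sp1 : S p.-1 < Q%:R by rewrite ltNge; apply/negP => /pmin; lia.
  rewrite p1 /S big_ord_recr /= -/(S p.-1).
  have N0N1 : (N0 <= N1)%N by rewrite leq_maxr.
  by have := HN0 p.-1 ltac:(lia); lra.
exists p, (e - p)%N; split.
- by rewrite (leq_trans _ (ltnW N1p)) // leq_maxl.
- move=> r rs.
  have -> : Num.truncn (S (p + r)) = Q.
    apply: truncn_def; rewrite (le_trans Qp) ?S_mono ?leq_addr //=.
    by rewrite ltNge; apply/negP => /emin; lia.
  by rewrite /Q modnMDl modn_small.
- have : S e = S p + \sum_(r < e - p) alpha (p + r)%N.
    rewrite /S; move: (e - p)%N (subnKC pe) => q <-; exact: big_split_ord.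
  move: Qe Sp; rewrite -[Q.+1%:R]natr1; move: (S e) (S p) (Q%:R) => a b c.
  lra.
Qed.

End Epochs.

(** * Weight matrices tilted towards one agent *)

Section CyclicWeights.
Variables (R : realType) (n : nat) (t : R).
Hypotheses (n0 : (0 < n)%N) (t01 : 0 < t < 1).

Definition tilted_weight (i j : 'I_n) : R := (1 - t) / n%:R + t * (i == j)%:R.

Let t_gt0 : 0 < t. Proof. by case/andP: t01. Qed.
Let t_lt1 : t < 1. Proof. by case/andP: t01. Qed.

Let eta_gt0 : 0 < (1 - t) / n%:R.
Proof. by rewrite divr_gt0 ?ltr0n // subr_gt0. Qed.

Lemma tilted_weight_ge i j : (1 - t) / n%:R <= tilted_weight i j.
Proof. by rewrite lerDl mulr_ge0 ?ler0n // ltW. Qed.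

Lemma tilted_weight_ge0 i j : 0 <= tilted_weight i j.
Proof. exact: le_trans (ltW eta_gt0) (tilted_weight_ge i j). Qed.

Lemma tilted_weight_sumM i (h : 'I_n -> R) :
  \sum_j tilted_weight i j * h j = (1 - t) / n%:R * (\sum_j h j) + t * h i.
Proof.
under eq_bigr => j _ do rewrite mulrDl.
rewrite big_split /= mulr_sumr; congr (_ + _).
rewrite (bigD1 i) //= eqxx mulr1 big1 ?addr0 // => j /negbTE ji.
by rewrite eq_sym ji mulr0 mul0r.
Qed.

Lemma tilted_weight_sum i : \sum_j tilted_weight i j = 1.
Proof.
have := tilted_weight_sumM i (fun=> 1); under eq_bigr => j _ do rewrite mulr1.
have nR : n%:R != 0 :> R by rewrite pnatr_eq0 -lt0n.
by move=> ->; rewrite sumr_const card_ord divfK // mulr1 subrK.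
Qed.

(** All rows are equal, so all agents compute the same average and a run is governed by a single
    sequence of points. *)
Definition tilted_matrices (idx : nat -> 'I_n) k : 'M[R]_n :=
  \matrix_(i, j) tilted_weight (idx k) j.

Lemma tilted_matrices_rule idx : weight_rule (tilted_matrices idx).
Proof.
split=> [k i j|k i|]; first by rewrite mxE tilted_weight_ge0.
  by under eq_bigr => j _ do rewrite mxE; exact: tilted_weight_sum.
exists ((1 - t) / n%:R) => [|i j k]; last by rewrite !mxE !tilted_weight_ge.
rewrite eta_gt0 /= ltr_pdivrMr ?ltr0n // mul1r.
apply: lt_le_trans (_ : 1 <= _); last by rewrite ler1n.
by rewrite ltrBlDr ltrDl.
Qed.

Lemma tilted_matrices_conn idx : UJSC (tilted_matrices idx).
Proof.
exists 1%N => // k i j _; apply: connect1; apply/existsP; exists ord0.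
by rewrite /edge mxE (lt_le_trans eta_gt0) // tilted_weight_ge.
Qed.

End CyclicWeights.

(** * Optimality of limits under tilted weights *)

Section Necessity.
Variables (R : realType) (m n : nat) (X : set 'rV[R]_m) (U : 'I_n -> set 'rV[R]_m).
Variables (f : 'I_n -> 'rV[R]_m -> R) (L : R) (alpha : nat -> R).
Hypotheses (X0 : X !=set0) (Xc : closed X) (Xv : convex_set X)
  (XU : forall i, X `<=` U i) (Uo : forall i, open (U i))
  (Uv : forall i, convex_set (U i)) (fv : forall i, convex_function (U i) (f i))
  (L0 : 0 < L)
  (fL : forall i x d, X x -> subdiff (U i) (f i) x d -> enorm d <= L)
  (alpha0 : forall k, 0 < alpha k).

Lemma run_exists (A : nat -> 'M[R]_n) :
  (forall k i j, 0 <= A k i j) -> (forall k i, \sum_j A k i j = 1) ->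
  exists x v d, generated X U f alpha A x v d /\ forall k i, X (x k i).
Proof.
move=> A0 A1; have [x0 Xx0] := X0.
pose g i y := xget 0 (subdiff (U i) (f i) y).
pose avg k (x : 'I_n -> 'rV[R]_m) i := \sum_j A k i j *: x j.
pose next k x i := Defs.proj X (avg k x i - alpha k *: g i (avg k x i)).
pose x := nat_rect (fun=> 'I_n -> 'rV[R]_m) (fun=> x0) next.
have xX k i : X (x k i) by case: k => [|k] //; exact: proj_in.
exists x, (fun k => avg k (x k)), (fun k i => g i (avg k (x k) i)); split=> // k i.
split=> //.
have [d dP] : subdiff (U i) (f i) (avg k (x k) i) !=set0.
  apply: (subdiff_nonempty (@Uo i) (@Uv i) (@fv i)); apply: (@XU i).
  exact: convex_set_sum.
exact: xgetI dP.
Qed.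

Variables (C t : R).
Hypotheses (alpha_div : forall b, exists N, b <= \sum_(k < N) alpha k)
  (alpha_sq : forall N, \sum_(k < N) alpha k ^+ 2 <= C)
  (n0 : (0 < n)%N) (t01 : 0 < t < 1).

(* The iterates produced with stepsize alpha_k are averaged by A (k + 1), whence
   the predecessor. *)
Definition epoch_index k : 'I_n :=
  Ordinal (ltn_pmod (Num.truncn (\sum_(r < k.-1) alpha r)) n0).

Let A := tilted_matrices t epoch_index.

(** If some [y] were better by [gap], every late epoch of [i] would bring the common average closer
    to [y] by a fixed amount, although that average converges to [z]. *)
Lemma tilted_limit_optimal (x v d : nat -> 'I_n -> 'rV[R]_m) z :
  generated X U f alpha A x v d -> (forall k i, X (x k i)) -> X z ->
  (forall e, 0 < e -> exists N, forall k, (N <= k)%N ->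
    forall i, enorm (x k i - z) < e) ->
  forall i y, X y ->
    \sum_j tilted_weight t i j * f j z <= \sum_j tilted_weight t i j * f j y.
Proof.
move=> gen xX zX xz i y Xy; rewrite leNgt; apply/negP => gap0.
pose Fw h u := \sum_j tilted_weight t h j * f j u.
pose gap := Fw i z - Fw i y.
have {}gap0 : 0 < gap by rewrite subr_gt0.
have w0 := @tilted_weight_ge0 R n t n0 t01; have w1 := @tilted_weight_sum R n t n0.
pose V k := \sum_j tilted_weight t (epoch_index k) j *: x k j.
have vV k h : v k h = V k.
  by have [-> _ _] := gen k h; apply: eq_bigr => j _; rewrite mxE.
have VX k : X (V k) by apply: convex_set_sum.
have Vz k e : (forall h, enorm (x k h - z) < e) -> enorm (V k - z) <= e.
  move=> xe; have := enorm_wsum (w0 (epoch_index k)) (fun j => ltW (xe j)).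
  rewrite w1 mul1r; under eq_bigr => j _ do rewrite scalerBr.
  by rewrite sumrB -scaler_suml w1 scale1r.
pose D k := dot (V k - y) (V k - y).
have Vstep k : D k.+1 <=
    D k - 2 * alpha k * (Fw (epoch_index k.+1) (V k) - Fw (epoch_index k.+1) y)
    + L ^+ 2 * alpha k ^+ 2.
  set h := epoch_index k.+1.
  apply: le_trans (dot_wsum (x k.+1) y (w0 h) (w1 h)) _.
  have H j : dot (x k.+1 j - y) (x k.+1 j - y) <=
     D k + L ^+ 2 * alpha k ^+ 2 - 2 * alpha k * (f j (V k) - f j y).
    have [_ vd ->] := gen k j; move: vd; rewrite vV => vd.
    have := subgradient_step X0 Xc Xv XU L0 fL (alpha0 k) (VX k) vd Xy.
    by rewrite /D; lra.
  apply: le_trans (ler_sum _ (fun j _ => ler_wpM2l (w0 h j) (H j))) _.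
  under eq_bigr => j _ do rewrite mulrBr.
  rewrite sumrB -mulr_suml w1 mul1r.
  have -> : \sum_j tilted_weight t h j * (2 * alpha k * (f j (V k) - f j y)) =
      2 * alpha k * (Fw h (V k) - Fw h y).
    rewrite -sumrB mulr_sumr; apply: eq_bigr => j _; ring.
  lra.
have Flsc k : Fw i z <= Fw i (V k) + L * enorm (V k - z).
  have H j : f j z <= f j (V k) + L * enorm (V k - z) by exact: subgradient_lsc.
  apply: le_trans (ler_sum _ (fun j _ => ler_wpM2l (w0 i j) (H j))) _.
  under eq_bigr => j _ do rewrite mulrDr.
  by rewrite big_split /= -mulr_suml w1 mul1r.
have [N1 HN1] : exists N, forall k, (N <= k)%N -> L * enorm (V k - z) <= gap / 2.
  have [|N HN] := xz (gap / 2 / L); first by rewrite !divr_gt0.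
  by exists N => k /HN /Vz; rewrite ler_pdivlMr // mulrC.
have [N2 HN2] : exists N, forall k, (N <= k)%N -> `|D k - dot (z - y) (z - y)| <= gap / 16.
  have E0 : 0 <= enorm (z - y) by exact: enorm_ge0.
  (* As [r <= 1], the change of the squared distance, at most [r ^+ 2 + 2 * r * enorm (z - y)], is
     at most [gap / 16]. *)
  pose r := Num.min 1 (gap / 16 / (1 + 2 * enorm (z - y))).
  have r0 : 0 < r by rewrite lt_min ltr01 !divr_gt0 //; lra.
  have r1 : r <= 1 by rewrite ge_min lexx.
  have r2 : r * (1 + 2 * enorm (z - y)) <= gap / 16.
    by rewrite -ler_pdivlMr ?ge_min ?lexx ?orbT //; lra.
  have [N HN] := xz r r0; exists N => k /HN /Vz Vr.
  rewrite /D; have -> : V k - y = (V k - z) + (z - y) by rewrite addrA subrK.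
  move: (V k - z) (z - y) Vr E0 r2 => p q Vr E0 r2.
  rewrite !(dotDl, dotDr) -!sqr_enorm (dotC q).
  have := dot_le p q; have := dot_le (- p) q; rewrite dotNl enormN.
  have := enorm_ge0 p.
  move: (enorm p) (dot p q) (enorm q) Vr E0 r2 => a b c ar c0 H a0 H1 H2.
  have : a * c <= r * c by rewrite ler_wpM2r.
  have : a ^+ 2 <= r by rewrite expr2; nra.
  rewrite ler_norml; have := sqr_ge0 a; lra.
have c0 k : 0 <= L ^+ 2 * alpha k ^+ 2 by rewrite mulr_ge0 ?sqr_ge0.
have cC N : \sum_(k < N) L ^+ 2 * alpha k ^+ 2 <= L ^+ 2 * C.
  by rewrite -mulr_sumr ler_wpM2l ?sqr_ge0.
have [|N3 HN3] := bounded_series_tail c0 cC (_ : 0 < gap / 8); first by rewrite divr_gt0.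
have alpha_small e : 0 < e -> exists N, forall k, (N <= k)%N -> alpha k < e.
  move=> e0; have [N HN] := stepsize_small L0 alpha0 alpha_sq (mulr_gt0 L0 e0).
  by exists N => k /HN; rewrite ltr_pM2l.
have [p [s [pN ps sum_s]]] := cyclic_epochs alpha0 alpha_div alpha_small
  (ltn_ord i) (maxn N1 (maxn N2 N3)).
have descent r : (r <= s)%N -> D (p + r)%N <=
   D p - gap * \sum_(l < r) alpha (p + l)%N + \sum_(l < r) L ^+ 2 * alpha (p + l)%N ^+ 2.
  elim: r => [_|r IH rs]; first by rewrite !big_ord0 addn0 mulr0 subr0 addr0.
  have idx : epoch_index (p + r).+1 = i by apply/val_inj => /=; exact: ps.
  rewrite !big_ord_recr /= addnS.
  have := Vstep (p + r)%N; rewrite idx.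
  have := IH (ltnW rs); have := Flsc (p + r)%N; have := HN1 (p + r)%N ltac:(lia).
  move=> H1 H2 H3.
  have : alpha (p + r)%N * gap <= 2 * alpha (p + r)%N * (Fw i (V (p + r)%N) - Fw i y).
    have := ltW (alpha0 (p + r)%N); rewrite /gap in H1 *; nra.
  lra.
(* The epoch forces a decrease of at least [gap / 2], while the stepsize errors and the variation of
   [D] account for at most [gap / 8] each. *)
have := descent s (leqnn s); have := HN3 p s ltac:(lia).
have := HN2 p ltac:(lia); have := HN2 (p + s)%N ltac:(lia).
rewrite !ler_norml => /andP[? ?] /andP[? ?].
have := ler_wpM2l (ltW gap0) sum_s; lra.
Qed.

End Necessity.

(** * Extended-real series as bounds on partial sums, and limits in epsilon form *)

Section SeriesBounds.
Variables (R : realType) (a : nat -> R).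
Hypothesis a0 : forall k, 0 <= a k.

Lemma unbounded_partial_sums :
  (\sum_(0 <= k <oo) (a k)%:E = +oo)%E -> forall b, exists N, b <= \sum_(k < N) a k.
Proof.
move=> a_oo b; apply: contrapT => H.
suff : (\sum_(0 <= k <oo) (a k)%:E <= b%:E)%E by rewrite a_oo leye_eq.
apply: lime_le.
  by apply: is_cvg_nneseries => k _ _; rewrite lee_fin.
apply: nearW => N; rewrite sumEFin lee_fin big_mkord leNgt; apply/negP => bN.
by apply: H; exists N; exact: ltW.
Qed.

Lemma bounded_partial_sums :
  (\sum_(0 <= k <oo) (a k)%:E < +oo)%E -> exists C, forall N, \sum_(k < N) a k <= C.
Proof.
move=> a_fin.
have le N : ((\sum_(k < N) a k)%:E <= \sum_(0 <= k <oo) (a k)%:E)%E.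
  have := @nneseries_lim_ge R (fun k => (a k)%:E) xpredT 0 N.
  by rewrite sumEFin big_mkord; apply=> k _ _; rewrite lee_fin.
exists (fine (\sum_(0 <= k <oo) (a k)%:E)%E) => N.
rewrite -lee_fin fineK // ge0_fin_numE //.
by apply: nneseries_ge0 => k _ _; rewrite lee_fin.
Qed.

End SeriesBounds.

Lemma cvgr0_nneg_epsP (R : realType) (u : nat -> R) : (forall k, 0 <= u k) ->
  (u k @[k --> \oo] --> (0 : R)) <->
  (forall e, 0 < e -> exists N, forall k, (N <= k)%N -> u k < e).
Proof.
move=> u0; split=> [/cvgrPdist_lt H e /H[N _ HN]|H].
  by exists N => k /HN; rewrite /= sub0r normrN ger0_norm.
apply/cvgrPdist_lt => e /H[N HN]; exists N => // k /= /HN.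
by rewrite sub0r normrN ger0_norm.
Qed.

Lemma uniform_eventually (n : nat) (P : nat -> 'I_n -> Prop) :
  (forall i, exists N, forall k, (N <= k)%N -> P k i) ->
  exists N, forall k, (N <= k)%N -> forall i, P k i.
Proof.
move=> /choice[N HN]; exists (\max_i N i)%N => k Nk i.
by apply: HN; apply: leq_trans Nk; exact: leq_bigmax.
Qed.

Theorem theorem2 (R : realType) (m n : nat)
    (X : set 'rV[R]_m) (U : 'I_n -> set 'rV[R]_m)
    (f : 'I_n -> 'rV[R]_m -> R) (L : R) (alpha : nat -> R)
    (X_neq0 : X !=set0) (X_closed : closed X) (X_convex : convex_set X)
    (U_open : forall i, open (U i)) (U_convex : forall i, convex_set (U i))
    (X_sub_U : forall i, X `<=` U i)
    (f_convex : forall i, convex_function (U i) (f i))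
    (L_gt0 : 0 < L)
    (subgradient_bound : forall i x d,
        X x -> subdiff (U i) (f i) x d -> enorm d <= L)
    (alpha_gt0 : forall k, 0 < alpha k)
    (alpha_sum : (\sum_(0 <= k <oo) (alpha k)%:E = +oo)%E)
    (alpha_sum_sq : (\sum_(0 <= k <oo) (alpha k ^+ 2)%:E < +oo)%E) :
  (forall A : nat -> 'M[R]_n, weight_rule A -> UJSC A ->
     achieves_solution X U f alpha A (fun x => \sum_(i < n) f i x))
  <-> \bigcap_(i in [set: 'I_n]) argmin X (f i) !=set0.
Proof.
have alpha_div := unbounded_partial_sums (fun k => ltW (alpha_gt0 k)) alpha_sum.
have [C alpha_sq] := bounded_partial_sums (fun k => sqr_ge0 (alpha k)) alpha_sum_sq.
have cvgP (w : nat -> 'rV[R]_m) := cvgr0_nneg_epsP (fun k => enorm_ge0 (w k)).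
split=> [achieve|[z0 z0_min] A A_rule A_conn x v d gen].
  (* Without agents the intersection is the whole space. *)
  case: (posnP n) => [n0|n0]; first by exists 0 => i _; have := ltn_ord i; lia.
  have limit t : 0 < t < 1 -> exists z, argmin X (fun x => \sum_i f i x) z /\
      forall i y, X y -> (1 - t) / n%:R * (\sum_j f j z) + t * f i z
        <= (1 - t) / n%:R * (\sum_j f j y) + t * f i y.
    move=> t01; set A := tilted_matrices t (epoch_index alpha n0).
    have A_rule : weight_rule A by exact: tilted_matrices_rule.
    have [A0 A1 _] := A_rule.
    have [x [v [d [gen xX]]]] := run_exists alpha X_neq0 X_closed X_convex X_sub_U
      U_open U_convex f_convex A0 A1.
    have [_ [z zF xz]] := achieve A A_rule (tilted_matrices_conn n0 t01 _) x v d gen.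
    exists z; split=> // i y Xy; rewrite -!tilted_weight_sumM //.
    apply: (tilted_limit_optimal X_neq0 X_closed X_convex X_sub_U U_open U_convex
      f_convex L_gt0 subgradient_bound alpha_gt0 alpha_div alpha_sq t01 gen xX) => //.
      by case: zF.
    by move=> e e0; apply: uniform_eventually => j; exact: ((cvgP _).1 (xz j)).
  have half01 : 0 < (1 / 2 : R) < 1 by apply/andP; split; lra.
  have [z [[Xz zF] z_opt]] := limit _ half01.
  exists z => i _; split=> // y Xy; rewrite leNgt; apply/negP => fyz.
  pose g := f i z - f i y.
  pose h := (n%:R)^-1 * (\sum_j f j y - \sum_j f j z).
  have g0 : 0 < g by rewrite subr_gt0.
  have h0 : 0 <= h by rewrite mulr_ge0 ?invr_ge0 ?ler0n // subr_ge0; exact: zF.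
  (* Optimality of [w] for [t = 1 - s], with [f i z <= f i w], gives [g <= s * (g + h)]; this [s]
     makes the right side [g / 2]. *)
  pose s := g / (2 * (g + h)).
  have sE : s * (g + h) = g / 2 by rewrite /s; field; lra.
  have s0 : 0 < s by rewrite divr_gt0 //; lra.
  have s1 : s < 1 by rewrite ltr_pdivrMr; lra.
  have t01 : 0 < 1 - s < 1 by apply/andP; split; lra.
  have [w [[Xw wF] w_opt]] := limit _ t01.
  have Fwz : \sum_j f j w = \sum_j f j z.
    by apply/eqP; rewrite eq_le wF // zF.
  (* Both points minimise the total objective, so its terms cancel in the optimality of [z]. *)
  have fzw : f i z <= f i w by have := z_opt i w Xw; rewrite Fwz; lra.
  have := w_opt i y Xy; rewrite Fwz.
  have -> : (1 - (1 - s)) / n%:R * (\sum_j f j y) =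
      (1 - (1 - s)) / n%:R * (\sum_j f j z) + s * h by rewrite /h; ring.
  have : (1 - s) * f i z <= (1 - s) * f i w by rewrite ler_wpM2l //; lra.
  move: (_ / n%:R * _) => q; rewrite /g in sE g0 *; lra.
(* The initial points may lie outside [X], but all later ones are projections; the run is therefore
   restarted at time 1. *)
pose alpha' k := alpha k.+1; pose A' k := A k.+1.
have alpha'_div b : exists N, b <= \sum_(k < N) alpha' k.
  have [N HN] := alpha_div (b + alpha 0); exists N.
  have : \sum_(k < N) alpha k <= \sum_(k < N.+1) alpha k.
    by rewrite big_ord_recr /= lerDl ltW.
  by rewrite big_ord_recl /= /alpha'; lra.
have alpha'_sq := bounded_series_shift (fun k => sqr_ge0 (alpha k)) alpha_sq 1.
have A'_rule : weight_rule A'.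
  have [A0 A1 [eta eta01 A_lb]] := A_rule.
  split=> [k i j|k i|]; [exact: A0|exact: A1|].
  by exists eta => // i j k; exact: A_lb.
have A'_conn : UJSC A' by have [B B0 sc] := A_conn; exists B => // k; exact: (sc k.+1).
have gen' : generated X U f alpha' A' (fun k => x k.+1) (fun k => v k.+1) (fun k => d k.+1).
  by move=> k i; exact: gen.
have xX k i : X (x k.+1 i) by have [_ _ ->] := gen k i; exact: proj_in.
have alpha'_gt0 k : 0 < alpha' k by exact: alpha_gt0.
have [zz [Xz z_min]] : exists z, X z /\ forall i y, X y -> f i z <= f i y.
  case: (posnP n) => [n0|n0].
    by have [z Xz] := X_neq0; exists z; split=> // i; have := ltn_ord i; lia.
  exists z0; split=> [|i y Xy]; first by have [] := z0_min (Ordinal n0) I.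
  by have [_] := z0_min i I; exact.
have [w [Xw w_min xw]] := run_converges X_neq0 X_closed X_convex X_sub_U U_open U_convex
  f_convex L_gt0 subgradient_bound alpha'_gt0 A'_rule A'_conn alpha'_div alpha'_sq gen' xX
  Xz z_min.
have {}xw e : 0 < e -> exists N, forall k, (N <= k)%N -> forall i, enorm (x k i - w) < e.
  by move=> /xw[N HN]; exists N.+1 => -[|k] // Nk i; exact: HN.
split=> [i j|].
  apply/cvgP => e e0; have [|N HN] := xw (e / 2); first by rewrite divr_gt0.
  exists N => k /HN xkw; apply: le_lt_trans (enorm_triangle _ _ w) _.
  by rewrite (enorm_distC w); have := xkw i; have := xkw j; lra.
exists w; first by split=> // y Xy; apply: ler_sum => i _; exact: w_min.
by move=> i; apply/cvgP => e /xw[N HN]; exists N => k /HN.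
Qed.
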